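(* Assume $r_0\ne0$. If $0\le n<N^*$, then the CG iterates satisfy $$w_{n+1}=w_n+\alpha_np_n,\quad\text{where }\alpha_n:=\frac{\|r_n\|^2}{(A_zp_n,p_n)}.$$
   Context: $V$ is a finite-dimensional complex inner product space of dimension $N$ with inner product $(\cdot,\cdot)$ (linear in the first argument) and norm $\|\cdot\|$; $A$ is a positive definite Hermitian operator on $V$; $z\in\mathbb C$ with $\arg z\in(-\pi,\pi)$; $A_z:=zI+A$. Given $g,w_0\in V$, let $r_0:=g-A_zw_0$, $V_0:=\{0\}$, $V_n:=\operatorname{span}\{r_0,A_zr_0,\dots,A_z^{n-1}r_0\}$ for $n\ge1$. The $n$th CG iterate is the unique $w_n\in w_0+V_n$ with $(A_zw_n,\varphi)=(g,\varphi)$ for all $\varphi\in V_n$, and $r_n:=g-A_zw_n$. If $r_0\neq0$, $N^*\le N$ denotes the integer such that $r_n\ne0$ for $0\le n<N^*$ and $r_n=0$ for $n\ge N^*$. The vectors $p_n$, $0\le n<N^*$, are defined recursively by $p_0:=r_0$ and, if $p_k\ne0$ for $0\le k\le n$, $$p_{n+1}:=r_{n+1}+\sum_{k=0}^n\beta_{nk}p_k,\qquad\beta_{nk}:=-\frac{(A_zr_{n+1},p_k)}{(A_zp_k,p_k)}.$$ *)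

(* Defs.v *)
From HB Require Import structures.
From mathcomp Require Import all_boot all_order all_algebra.
From mathcomp Require Import complex.
From mathcomp Require Import all_classical all_reals all_analysis.
Set Implicit Arguments.
Unset Strict Implicit.
Unset Printing Implicit Defensive.
Import Order.TTheory GRing.Theory Num.Theory Num.Def.
Local Open Scope ring_scope.
Local Open Scope complex_scope.

(* The principal argument, with values in ]-pi, pi] and the convention that
   the argument of 0 is 0. *)
Definition Carg (R : realType) (z : R[i]) : R :=
  let t := complex.Re z
             / Num.sqrt (complex.Re z ^+ 2 + complex.Im z ^+ 2) in
  if z == 0 then 0 else if 0 <= complex.Im z then acos t else - acos t.

Section ConjugateGradient.
Variables (R : realType) (V : vectType R[i]).
(* An inner product is linear in its first argument and conjugate-linear in
   its second one. *)
Variable ip : {dot V for (@conjC R[i])}.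

(* The norm is real and nonnegative, as an element of R[i]. *)
Definition ipnorm (v : V) : R[i] := sqrtC (ip v v).

Definition hermitian_op (A : 'End(V)) : Prop :=
  forall u v : V, ip (A u) v = ip u (A v).

Definition posdef_op (A : 'End(V)) : Prop :=
  forall u : V, u != 0 -> 0 < ip (A u) u.

Definition shift_op (z : R[i]) (A : 'End(V)) : 'End(V) := z *: \1%VF + A.

Definition krylov (B : 'End(V)) (r : V) (n : nat) : {vspace V} :=
  <<[seq iter k B r | k <- iota 0 n]>>%VS.

Definition residual (B : 'End(V)) (g w : V) : V := g - B w.

Definition cg_iterates (B : 'End(V)) (g w0 : V) (w : nat -> V) : Prop :=
  forall n : nat,
    let Vn := krylov B (residual B g w0) n in
    w n - w0 \in Vn /\
    (forall phi : V, phi \in Vn -> ip (B (w n)) phi = ip g phi).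

Definition cg_stop_index (r : nat -> V) (Nstar : nat) : Prop :=
  [/\ (Nstar <= \dim {:V})%N,
      forall n : nat, (n < Nstar)%N -> r n != 0 &
      forall n : nat, (Nstar <= n)%N -> r n = 0].

Definition cg_beta (B : 'End(V)) (r p : nat -> V) (n k : nat) : R[i] :=
  - (ip (B (r n.+1)) (p k) / ip (B (p k)) (p k)).

(* Only the values p 0, ..., p Nstar.-1 are constrained, and p n.+1 only when
   p 0, ..., p n do not vanish, so that no denominator is zero. *)
Definition cg_directions (B : 'End(V)) (r : nat -> V) (Nstar : nat)
    (p : nat -> V) : Prop :=
  p 0%N = r 0%N /\
  (forall n : nat, (n.+1 < Nstar)%N ->
     (forall k : nat, (k <= n)%N -> p k != 0) ->
     p n.+1 = r n.+1 + \sum_(k < n.+1) cg_beta B r p n k *: p k).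

Definition cg_alpha (B : 'End(V)) (r p : nat -> V) (n : nat) : R[i] :=
  ipnorm (r n) ^+ 2 / ip (B (p n)) (p n).

End ConjugateGradient.

(* Main.v *)
Require Import Defs.
From HB Require Import structures.
From mathcomp Require Import all_boot all_order all_algebra.
From mathcomp Require Import complex.
From mathcomp Require Import all_classical all_reals all_analysis.
Set Implicit Arguments.
Unset Strict Implicit.
Unset Printing Implicit Defensive.
Import Order.TTheory GRing.Theory Num.Theory Num.Def.
Local Open Scope ring_scope.
Local Open Scope complex_scope.

(** The restriction on [arg z] excludes exactly the negative reals, while
    [(Az v, v) = z (v, v) + (A v, v)] can only vanish for [v != 0] when [z] is
    minus a quotient of two positive reals; hence [(Az v, v) != 0] for all
    [v != 0] ([shift_form_neq0]), and the Galerkin equations on a given Krylov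
    space have at most one solution ([galerkin_unique]).

    It remains to see that [w n + alpha_n p_n] solves the equations defining
    [w n.+1].  Write [V_n] for the Krylov spaces.  The residual [r n] lies in
    [V_(n+1)] and is orthogonal to [V_n].  By induction on [n], [p n - r n] lies
    in [V_n] and [Az (p n)] is orthogonal to [V_n] ([cg_directions_inv]): as [A]
    is self-adjoint and maps [V_n] to [V_(n+1)], the coefficient [beta_nk]
    vanishes for [k < n], so that [p n.+1 = r n.+1 + beta_nn p n], and [beta_nn]
    is chosen to make [Az (p n.+1)] orthogonal to [p n].  The form [(Az u, v)]
    is not Hermitian when [z] is not real, which is why it is the vanishing of
    these coefficients, and not the symmetry of conjugacy, that is used.
    Finally [p n] is not in [V_n], so that [V_(n+1)] is [V_n] plus the line of
    [p n] ([krylov_split]), and testing [r n - alpha_n Az (p n)] against [V_n]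
    and against [p n] gives zero, the latter because
    [(r n, p n) = (r n, r n)]. *)

Lemma Carg_lt0 (R : realType) (z : R[i]) : z < 0 -> Carg z = pi.
Proof.
case: z => a b; rewrite ltcE /= => /andP[/eqP b0 a_lt0].
rewrite -b0 /Carg /= eq_complex /= eqxx andbT lt_eqF // lexx.
rewrite expr0n /= addr0 sqrtr_sqr ltr0_norm // invrN mulrN divff ?lt_eqF //.
exact: acosN1.
Qed.

Section Krylov.
Variables (R : realType) (V : vectType R[i]) (B : 'End(V)) (r : V).

Lemma krylovS n :
  krylov B r n.+1 = (krylov B r n + <[iter n B r]>)%VS.
Proof. by rewrite /krylov -addn1 iotaD map_cat span_cat /= span_seq1. Qed.

Lemma krylov_le m n : (m <= n)%N -> (krylov B r m <= krylov B r n)%VS.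
Proof.
move=> /subnK <-; elim: (n - m)%N => [|k IH]; first exact: subvv.
by rewrite addSn krylovS (subv_trans IH) ?addvSl.
Qed.

Lemma mem_krylov_op n v : v \in krylov B r n -> B v \in krylov B r n.+1.
Proof.
elim: n v => [|n IH] v.
  by rewrite {1}/krylov /= span_nil memv0 => /eqP->; rewrite linear0 mem0v.
rewrite {1}krylovS => /memv_addP[u uK [_ /vlineP[c ->] ->]].
rewrite linearD linearZ rpredD //.
  by rewrite (subvP (krylov_le (leqnSn _))) ?IH.
by rewrite rpredZ // -iterS krylovS (subvP (addvSr _ _)) ?memv_line.
Qed.

(** A vector of [V_(n+1)] outside [V_n] can replace the last Krylov vector. *)
Lemma krylov_split n p v : p \in krylov B r n.+1 -> p \notin krylov B r n ->
  v \in krylov B r n.+1 -> exists2 u, u \in krylov B r n &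
    exists c : R[i], v = u + c *: p.
Proof.
rewrite krylovS => /memv_addP[q qK [_ /vlineP[d ->] ->]] pNK.
have d0 : d != 0.
  by apply: contraNneq pNK => ->; rewrite scale0r addr0.
move=> /memv_addP[u uK [_ /vlineP[c ->] ->]].
exists (u - (c / d) *: q); first by rewrite rpredB ?rpredZ.
by exists (c / d); rewrite scalerDr scalerA divfK // addrA subrK.
Qed.

End Krylov.

Section Shift.
Variables (R : realType) (V : vectType R[i]) (ip : {dot V for (@conjC R[i])}).
Variables (A : 'End(V)) (z : R[i]).
Hypotheses (A_hermitian : hermitian_op ip A) (A_posdef : posdef_op ip A).
Hypothesis arg_z : - pi < Carg z < pi.

Let Az := shift_op z A.

Lemma shift_opE v : Az v = z *: v + A v.
Proof. by rewrite /Az /shift_op lfunE /= lfunE /= id_lfunE. Qed.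

Lemma shift_form_neq0 v : v != 0 -> ip (Az v) v != 0.
Proof.
move=> v0; apply: contraTneq arg_z => Bv0.
suff /Carg_lt0-> : z < 0 by rewrite ltxx andbF.
have vv_gt0 : 0 < ip v v := neq0_dnorm_gt0 v v0.
rewrite -(pmulr_llt0 _ vv_gt0).
move: Bv0; rewrite shift_opE linearDl linearZl_LR /= => /eqP.
by rewrite addr_eq0 => /eqP->; rewrite oppr_lt0 A_posdef.
Qed.

(** A vector orthogonal to [V_(n+1)] has an [A]-image, hence an [Az]-image,
    orthogonal to [V_n]. *)
Lemma shift_op_orth (r s phi : V) n :
    (forall psi, psi \in krylov Az r n.+1 -> ip s psi = 0) ->
  phi \in krylov Az r n -> ip (Az s) phi = 0.
Proof.
move=> s_orth phiK.
have phiKS : phi \in krylov Az r n.+1 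
  by rewrite (subvP (krylov_le _ _ (leqnSn _))).
have AphiK : A phi \in krylov Az r n.+1.
  have -> : A phi = Az phi - z *: phi by rewrite shift_opE addrC addKr.
  by rewrite rpredB ?rpredZ ?mem_krylov_op.
rewrite shift_opE linearDl linearZl_LR /= A_hermitian.
by rewrite !s_orth // mulr0 addr0.
Qed.

(** The difference [x - y] is itself a test vector. *)
Lemma galerkin_unique (U : {vspace V}) (x y : V) : x - y \in U ->
  (forall phi, phi \in U -> ip (Az x) phi = ip (Az y) phi) -> x = y.
Proof.
move=> xyU eq_xy; apply/eqP; rewrite -subr_eq0; apply: contraT.
by move=> /shift_form_neq0; rewrite (linearB Az) linearBl /= eq_xy // subrr eqxx.
Qed.

Variables (g w0 : V) (w : nat -> V).
Hypothesis w_cg : cg_iterates ip Az g w0 w.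

Let r0 := residual Az g w0.
Let r n := residual Az g (w n).
Let K n := krylov Az r0 n.

Lemma cg_residual_orth n phi : phi \in K n -> ip (r n) phi = 0.
Proof.
by move=> phiK; rewrite /r /residual linearBl /= (w_cg n).2 ?subrr.
Qed.

Lemma cg_residual_mem n : r n \in K n.+1.
Proof.
have -> : r n = r0 - Az (w n - w0).
  by rewrite /r /r0 /residual linearB opprB addrA subrK.
rewrite rpredB ?mem_krylov_op ?(w_cg n).1 //.
by rewrite (subvP (krylov_le _ _ (ltn0Sn n))) // memv_span //= inE.
Qed.

Variables (Nstar : nat) (p : nat -> V).
Hypothesis r_neq0 : forall n, (n < Nstar)%N -> r n != 0.
Hypothesis p_cg : cg_directions ip Az r Nstar p.

(** A direction that is the residual up to an element of [V_n] is a new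
    direction, as [r n] is nonzero and orthogonal to [V_n]. *)
Lemma cg_direction_notin n :
  (n < Nstar)%N -> p n - r n \in K n -> p n \notin K n.
Proof.
move=> ltnN prK; apply: contra (r_neq0 ltnN) => pK.
have rK : r n \in K n by rewrite -[r n](subKr (p n)) rpredB.
apply: contraT => /(@neq0_dnorm_gt0 _ _ _ ip).
by rewrite cg_residual_orth ?ltxx.
Qed.

Lemma cg_direction_mem n : p n - r n \in K n -> p n \in K n.+1.
Proof.
move=> prK; rewrite -[p n](subrK (r n)) rpredD ?cg_residual_mem //.
exact: subvP (krylov_le _ _ (leqnSn n)) _ prK.
Qed.

Lemma cg_directions_inv n : (n < Nstar)%N ->
  p n - r n \in K n /\ (forall phi, phi \in K n -> ip (Az (p n)) phi = 0).
Proof.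
have [p0 pS] := p_cg.
elim/ltn_ind: n => -[|n] IH ltnN.
  rewrite p0 subrr mem0v; split=> // phi.
  rewrite /K /krylov /= span_nil memv0 => /eqP->.
  exact: linear0r.
have {}IH k : (k <= n)%N ->
    p k - r k \in K k /\ (forall phi, phi \in K k -> ip (Az (p k)) phi = 0).
  by move=> lekn; apply: IH => //; rewrite (leq_ltn_trans lekn) // ltnW.
have pNK k : (k <= n)%N -> p k \notin K k.
  move=> lekn; apply: cg_direction_notin; last exact: (IH k lekn).1.
  exact: leq_ltn_trans lekn (ltnW ltnN).
have p_neq0 k : (k <= n)%N -> p k != 0.
  by move=> /pNK; apply: contraNneq => ->; rewrite mem0v.
have Kp : p n \in K n.+1 := cg_direction_mem (IH n (leqnn n)).1.
have Br_orth phi : phi \in K n -> ip (Az (r n.+1)) phi = 0.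
  by apply: shift_op_orth => psi; apply: cg_residual_orth.
(* All coefficients but the last one vanish. *)
have {}pS : p n.+1 = r n.+1 + cg_beta ip Az r p n n *: p n.
  rewrite pS // big_ord_recr /= big1 ?add0r // => k _.
  rewrite /cg_beta Br_orth ?mul0r ?oppr0 ?scale0r //.
  have pK := cg_direction_mem (IH k (ltnW (ltn_ord k))).1.
  exact: subvP (krylov_le _ _ (ltn_ord k)) _ pK.
split; first by rewrite pS addrAC subrr add0r rpredZ.
have Bp_orth phi : phi \in K n -> ip (Az (p n.+1)) phi = 0.
  move=> phiK; rewrite pS linearD linearZ linearDl linearZl_LR /=.
  by rewrite Br_orth // (IH n (leqnn n)).2 // mulr0 addr0.
move=> phi /(krylov_split Kp (pNK n (leqnn n)))[u uK [c ->]].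
rewrite linearDr linearZr_LR /= Bp_orth // add0r.
rewrite pS linearD linearZ linearDl linearZl_LR /= /cg_beta.
by rewrite mulNr divfK ?shift_form_neq0 ?p_neq0 // subrr mulr0.
Qed.

Lemma cg_step n : (n < Nstar)%N ->
  w n.+1 = w n + cg_alpha ip Az r p n *: p n.
Proof.
move=> ltnN; have [prK Bp_orth] := cg_directions_inv ltnN.
have pNK := cg_direction_notin ltnN prK.
have pK := cg_direction_mem prK.
have p_neq0 : p n != 0 by apply: contraNneq pNK => ->; rewrite mem0v.
apply: (@galerkin_unique (K n.+1)).
  rewrite -(subrKA w0) rpredD ?(w_cg n.+1).1 // -opprB rpredN addrAC.
  by rewrite rpredD ?rpredZ // (subvP (krylov_le _ _ (leqnSn n))) ?(w_cg n).1.
move=> phi phiK; rewrite (w_cg n.+1).2 //; apply/eqP; rewrite -subr_eq0.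
rewrite linearD linearZ -linearBl /= opprD addrA.
rewrite -/(residual Az g (w n)) -/(r n).
have [u uK [c ->]] := krylov_split pK pNK phiK.
have rp : ip (r n) (p n) = ip (r n) (r n).
  by rewrite -{1}[p n](subrK (r n)) linearDr /= cg_residual_orth // add0r.
have ip_diff psi : ip (r n - cg_alpha ip Az r p n *: Az (p n)) psi =
    ip (r n) psi - cg_alpha ip Az r p n * ip (Az (p n)) psi.
  by rewrite linearBl linearZl_LR.
rewrite linearDr linearZr_LR /= !ip_diff.
rewrite cg_residual_orth // Bp_orth // mulr0 subrr add0r rp.
by rewrite /cg_alpha /ipnorm sqrtCK divfK ?shift_form_neq0 // subrr mulr0.
Qed.

End Shift.

Theorem proposition4p3 (R : realType) (V : vectType R[i])
    (ip : {dot V for (@conjC R[i])}) (A : 'End(V)) (z : R[i])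
    (A_hermitian : hermitian_op ip A) (A_posdef : posdef_op ip A)
    (arg_z : - pi < Carg z < pi)
    (g w0 : V) (w : nat -> V)
    (w_cg : cg_iterates ip (shift_op z A) g w0 w)
    (r0_neq0 : residual (shift_op z A) g w0 != 0) :
  let Az := shift_op z A in
  let r := fun n : nat => residual Az g (w n) in
  forall (Nstar : nat) (p : nat -> V),
    cg_stop_index r Nstar ->
    cg_directions ip Az r Nstar p ->
    forall n : nat, (n < Nstar)%N ->
      w n.+1 = w n + cg_alpha ip Az r p n *: p n.
Proof.
move=> Az r Nstar p [_ r_neq0 _] p_cg n ltnN.
exact: (cg_step A_hermitian A_posdef arg_z w_cg r_neq0 p_cg ltnN).
Qed.
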